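(* Let $d\in\mathbb{N}$ and $n\geq 3$, and let $k$ be a nonnegative integer with $k\leq \frac{n}{10^4 d^3}$. Let $G$ and $H$ be graphs on $n$ vertices, each with average degree at most $d$. Suppose $G$ and $H$ share $n-k$ cards, i.e. there are distinct vertices $u_1,\dots,u_{n-k}$ of $G$ and distinct vertices $w_1,\dots,w_{n-k}$ of $H$ such that $G-u_i\cong H-w_i$ for every $i\in[n-k]$. Then $G$ and $H$ have the same degree sequence. (That is, the degree sequence of a graph with average degree at most $d$ can be reconstructed from its deck when at most $\frac{n}{10^4d^3}$ of the cards are missing.) *)

(* Defs.v *)
From mathcomp Require Import all_boot.
Set Implicit Arguments. Unset Strict Implicit. Unset Printing Implicit Defensive.

Definition simple_graph (n : nat) (G : rel 'I_n) : Prop :=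
  symmetric G /\ irreflexive G.

Definition deg (n : nat) (G : rel 'I_n) (v : 'I_n) : nat := #|[set w | G v w]|.

Definition avg_deg_le (n : nat) (G : rel 'I_n) (d : nat) : Prop :=
  \sum_(v : 'I_n) deg G v <= d * n.

Definition card_del (n : nat) (G : rel 'I_n) (u : 'I_n) : rel {x : 'I_n | x != u} :=
  fun x y => G (val x) (val y).

Arguments card_del {n} G u.

Definition graph_iso (T1 T2 : finType) (e1 : rel T1) (e2 : rel T2) : Prop :=
  exists f : T1 -> T2, bijective f /\ forall x y, e1 x y = e2 (f x) (f y).

Definition same_degree_sequence (n : nat) (G H : rel 'I_n) : Prop :=
  perm_eq [seq deg G v | v <- enum 'I_n] [seq deg H v | v <- enum 'I_n].

(* Main.v *)
Require Import Defs.
From mathcomp Require Import all_boot zify.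

Set Implicit Arguments.
Unset Strict Implicit.
Unset Printing Implicit Defensive.

(* Let A_j be the number of vertices of degree at least j, a_j the number of degree
   exactly j, and N_j(v) the number of neighbours of v of degree j. Deleting v lowers
   A_j by [deg v >= j] + N_j(v). Once G and H are known to have equally many edges,
   matched vertices u_i, w_i have equal degrees, so
     A_j(G) - A_j(H) = N_j(u_i) - N_j(w_i)   for every i and j.
   Suppose A_j agrees for all j > q and A_q(G) = A_q(H) + s with s > 0. Summing over i,
     (n - k - q) s = e(M_H, V_q(H)) - e(M_G, V_q(G)),
   where M_G, M_H are the k unmatched vertices and V_q the vertices of degree q.
   - If q > 10 k d^2, there are few vertices of degree q or q - 1, so the right side is
     small; this forces q to be close to n, and the analogous identity at q - 1 fails.
   - If q <= 10 k d^2, the right side is dominated by vertices of degree at least 40 d.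
     The number of edges from such vertices to V_q is nearly the same in G and H, as
     seen on a single card with deg u_i <= d; the matched ones contribute nearly the
     same by the displayed formula; hence so do the unmatched ones, a contradiction.
   Equality of the edge numbers follows from a similar comparison of the sums of
   (deg v - 3 d)^+. *)

(** * Degree statistics of a graph *)

Definition deg_del (n : nat) (G : rel 'I_n) (u x : 'I_n) : nat :=
  deg G x - G x u.

Definition num_deg_ge (n : nat) (G : rel 'I_n) (j : nat) : nat :=
  \sum_(v : 'I_n) (j <= deg G v).

Definition num_deg_eq (n : nat) (G : rel 'I_n) (j : nat) : nat :=
  \sum_(v : 'I_n) (deg G v == j).

Definition nbrs_deg_eq (n : nat) (G : rel 'I_n) (j : nat) (u : 'I_n) : nat :=
  \sum_(v : 'I_n) (G u v && (deg G v == j)).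

(** Ordered adjacent pairs with a threshold at both ends: deleting a vertex can only lower this
    count, which would fail for an exact degree. Exact degrees are recovered by differencing in
    [j]. *)
Definition edges_ge_ge (n : nat) (G : rel 'I_n) (h j : nat) : nat :=
  \sum_(x : 'I_n) \sum_(y : 'I_n) [&& G x y, h <= deg G x & j <= deg G y].

(* Truncated subtraction: vertices of degree at most [h] contribute 0. *)
Definition excess (n : nat) (G : rel 'I_n) (h : nat) : nat :=
  \sum_(v : 'I_n) (deg G v - h).

Lemma degE (n : nat) (G : rel 'I_n) (v : 'I_n) : deg G v = \sum_w (G v w : nat).
Proof.
rewrite /deg -sum1_card big_mkcond; apply: eq_bigr => w _.
by rewrite inE; case: (G v w).
Qed.

Lemma deg_gt0 (n : nat) (G : rel 'I_n) (v w : 'I_n) : G v w -> 0 < deg G v.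
Proof. by move=> vw; apply/card_gt0P; exists w; rewrite inE. Qed.

(** * Quantities preserved by an isomorphism of cards *)

Lemma card_del_deg (n : nat) (G : rel 'I_n) (u : 'I_n) (x : {x : 'I_n | x != u}) :
  \sum_y (card_del G u x y : nat) = deg_del G u (val x).
Proof.
rewrite /deg_del degE (bigD1 u) //= addKn.
by rewrite (big_sub (fun y => y != u) (fun y => G (val x) y : nat)).
Qed.

Lemma graph_iso_sym (S T : finType) (e : rel S) (f : rel T) :
  graph_iso e f -> graph_iso f e.
Proof.
move=> [g [[g' gK g'K] geq]]; exists g'; split; first by exists g.
by move=> x y; rewrite geq !g'K.
Qed.

(** An isomorphism preserves the degrees inside a card. [F] will be the identity, a truncated
    subtraction and a threshold test. *)
Lemma iso_sum_deg (n : nat) (G H : rel 'I_n) (u w : 'I_n) (F : nat -> nat) :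
  graph_iso (card_del G u) (card_del H w) ->
  \sum_(x | x != u) F (deg_del G u x) = \sum_(y | y != w) F (deg_del H w y).
Proof.
move=> [f [bf feq]].
rewrite (big_sub (fun x => x != u) (fun x => F (deg_del G u x))).
rewrite (big_sub (fun x => x != w) (fun x => F (deg_del H w x))).
rewrite [RHS](reindex f) /=; last exact: onW_bij.
apply: eq_bigr => x _; rewrite -!card_del_deg; congr F.
rewrite [RHS](reindex f) /=; last exact: onW_bij.
by apply: eq_bigr => y _; rewrite feq.
Qed.

Lemma iso_sum_edges (n : nat) (G H : rel 'I_n) (u w : 'I_n) (P : nat -> nat -> bool) :
  graph_iso (card_del G u) (card_del H w) ->
  \sum_(x | x != u) \sum_(y | y != u) (G x y && P (deg_del G u x) (deg_del G u y)) =
  \sum_(x | x != w) \sum_(y | y != w) (H x y && P (deg_del H w x) (deg_del H w y)).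
Proof.
move=> [f [bf feq]].
have degf z : deg_del G u (val z) = deg_del H w (val (f z)).
  rewrite -!card_del_deg [RHS](reindex f) /=; last exact: onW_bij.
  by apply: eq_bigr => y _; rewrite feq.
rewrite (big_sub (fun x => x != u) (fun x => \sum_(y | y != u) _)).
rewrite (big_sub (fun x => x != w) (fun x => \sum_(y | y != w) _)).
rewrite [RHS](reindex f) /=; last exact: onW_bij.
apply: eq_bigr => x _.
rewrite (big_sub (fun y => y != u) (fun y => nat_of_bool (G (val x) y && _ _ (_ _ _ y)))).
rewrite (big_sub (fun y => y != w) (fun y => nat_of_bool (H (val (f x)) y && _ _ (_ _ _ y)))).
rewrite [RHS](reindex f) /=; last exact: onW_bij.
by apply: eq_bigr => y _; rewrite !degf -/(card_del G u x y) feq.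
Qed.

(** * Effect of deleting one vertex *)

Lemma num_deg_ge_del (n : nat) (G : rel 'I_n) (j : nat) (u : 'I_n) :
  simple_graph G ->
  num_deg_ge G j =
    \sum_(x | x != u) (j <= deg_del G u x) + (j <= deg G u) + nbrs_deg_eq G j u.
Proof.
move=> [sG iG]; rewrite /num_deg_ge /nbrs_deg_eq (bigD1 u) //=.
rewrite [X in _ = _ + X](bigD1 u) //= iG /= add0n addnAC addnC -big_split /=; congr addn.
apply: eq_bigr => v vu; rewrite /deg_del (sG u v).
(* A neighbour of [u] has positive degree; with truncated subtraction the identity at [j = 0]
   depends on this. *)
case: (boolP (G v u)) => [/deg_gt0|_] /=; lia.
Qed.

Lemma sum_deg_del (n : nat) (G : rel 'I_n) (u : 'I_n) :
  simple_graph G ->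
  \sum_v deg G v = \sum_(x | x != u) deg_del G u x + 2 * deg G u.
Proof.
move=> [sG iG]; rewrite (bigD1 u) //= mul2n -addnn addnA addnC; congr addn.
rewrite [X in _ = _ + X]degE [X in _ = _ + X](bigD1 u) //= iG add0n -big_split /=.
apply: eq_bigr => v vu; rewrite /deg_del (sG u v).
case: (boolP (G v u)) => [/deg_gt0|_] /=; lia.
Qed.

Lemma sum_deg_del_excess (n : nat) (G : rel 'I_n) (h : nat) (u : 'I_n) :
  \sum_(x | x != u) (deg_del G u x - h) <= excess G h.
Proof.
rewrite /excess [X in _ <= X](bigD1 u) //=; apply: leq_trans (leq_addl _ _).
apply: leq_sum => v _; rewrite /deg_del; lia.
Qed.

(** The vertex [u] takes away at most [deg G u], and each of its neighbours loses at most one. *)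
Lemma excess_del (n : nat) (G : rel 'I_n) (h : nat) (u : 'I_n) :
  simple_graph G ->
  excess G h <= \sum_(x | x != u) (deg_del G u x - h) + 2 * deg G u.
Proof.
move=> [sG iG]; rewrite /excess (bigD1 u) //= mul2n -addnn addnA addnC.
apply: leq_add; last exact: leq_subr.
rewrite [X in _ <= _ + X]degE [X in _ <= _ + X](bigD1 u) //= iG add0n -big_split /=.
apply: leq_sum => v vu; rewrite /deg_del (sG u v); lia.
Qed.

Lemma edges_ge_ge_del_le (n : nat) (G : rel 'I_n) (h j : nat) (u : 'I_n) :
  \sum_(x | x != u) \sum_(y | y != u)
    (G x y && ((h <= deg_del G u x) && (j <= deg_del G u y))) <= edges_ge_ge G h j.
Proof.
rewrite /edges_ge_ge [X in _ <= X](bigD1 u) //=; apply: leq_trans (leq_addl _ _).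
apply: leq_sum => x _; rewrite [X in _ <= X](bigD1 u) //=.
apply: leq_trans (leq_addl _ _).
apply: leq_sum => y _; rewrite /deg_del; case: (G x y) => //=; lia.
Qed.

Lemma sum_adj_deg_le (n : nat) (G : rel 'I_n) (h : nat) (u : 'I_n) :
  symmetric G ->
  \sum_x \sum_y [&& G x y, G x u & deg G x == h] <= h * deg G u.
Proof.
move=> sG; rewrite [X in _ * X]degE big_distrr /=; apply: leq_sum => x _.
rewrite (sG u x).
case: (G x u); last by rewrite big1 => // y _; rewrite andbF.
case: eqP => [<-|_]; last by rewrite big1 // => y; rewrite !andbF.
by rewrite muln1 degE; apply: leq_sum => y _; rewrite !andbT.
Qed.

(** A pair is lost if it contains [u], or if an end is a neighbour of [u] whose degree is exactly
    its threshold. Such a neighbour lies in only [h] (or [j]) pairs, whence the factor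
    [2 + h + j]. *)
Lemma edges_ge_ge_del (n : nat) (G : rel 'I_n) (h j : nat) (u : 'I_n) :
  simple_graph G ->
  edges_ge_ge G h j <=
    \sum_(x | x != u) \sum_(y | y != u)
      (G x y && ((h <= deg_del G u x) && (j <= deg_del G u y)))
    + (2 + h + j) * deg G u.
Proof.
move=> [sG iG].
have hx := sum_adj_deg_le h u sG.
have hy := sum_adj_deg_le j u sG; rewrite exchange_big /= in hy.
have gu : \sum_x \sum_y ((x == u) && G x y : nat) = deg G u.
  rewrite (bigD1 u) //= [X in _ + X]big1 ?addn0; first by rewrite degE; apply: eq_bigr => y _; rewrite eqxx.
  by move=> x /negbTE xu; rewrite big1 // => y _; rewrite xu.
have ug : \sum_x \sum_y ((y == u) && G x y : nat) = deg G u.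
  rewrite exchange_big /= -gu; apply: eq_bigr => x _; apply: eq_bigr => y _.
  by rewrite sG.
have -> : \sum_(x | x != u) \sum_(y | y != u)
      (G x y && ((h <= deg_del G u x) && (j <= deg_del G u y))) =
    \sum_x \sum_y [&& x != u, y != u, G x y, h <= deg_del G u x & j <= deg_del G u y].
  rewrite big_mkcond; apply: eq_bigr => x _; case: (x != u); last by rewrite big1.
  by rewrite big_mkcond; apply: eq_bigr => y _; case: (y != u).
set C := \sum_x \sum_y (_ : nat).
suff: edges_ge_ge G h j <= C + deg G u + deg G u
   + \sum_x \sum_y [&& G x y, G x u & deg G x == h]
   + \sum_y \sum_x [&& G x y, G x u & deg G x == j].
  move/leq_trans; apply; rewrite !mulnDl mul2n -addnn -!addnA !leq_add2l.
  exact: leq_add.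
rewrite -{1}gu -ug /C -!big_split.
apply: leq_sum => x _; rewrite -!big_split; apply: leq_sum => y _ /=.
rewrite (sG y x) /deg_del.
case xy: (G x y) => //=; rewrite !andbT.
have [xu|xu] := eqVneq x u; first by lia.
have [yu|yu] := eqVneq y u; first by lia.
move: (deg_gt0 xy); rewrite sG in xy; move: (deg_gt0 xy).
by case: (G x u); case: (G y u) => /=; lia.
Qed.

(** * Splitting sums into shared and missing vertices *)

Lemma sum_codom_split (m n : nat) (u : 'I_m -> 'I_n) (F : 'I_n -> nat) :
  injective u ->
  \sum_v F v = \sum_i F (u i) + \sum_(v | v \notin codom u) F v.
Proof.
move=> u_inj; rewrite (bigID (mem (codom u))) /=; congr addn.
rewrite -big_uniq /=; last by rewrite map_inj_uniq ?enum_uniq.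
by rewrite big_image.
Qed.

Lemma card_notin_codom (k n : nat) (u : 'I_(n - k) -> 'I_n) :
  k <= n -> injective u -> #|[pred v | v \notin codom u]| = k.
Proof.
move=> le_kn u_inj; have := cardC (mem (codom u)).
rewrite card_codom // !card_ord => cE.
by apply: (@addnI (n - k)); rewrite subnK // -[RHS]cE; congr addn; apply: eq_card.
Qed.

Lemma sum_notin_codom_le (k n c : nat) (u : 'I_(n - k) -> 'I_n) (F : 'I_n -> nat) :
  k <= n -> injective u -> (forall v, F v <= c) ->
  \sum_(v | v \notin codom u) F v <= k * c.
Proof.
move=> le_kn u_inj leF; rewrite -{2}(card_notin_codom le_kn u_inj) -sum_nat_const.
by apply: leq_sum.
Qed.

(** * Double counting and Markov bounds *)

Lemma sum_nbrs_deg_eq (n : nat) (G : rel 'I_n) (j : nat) :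
  symmetric G -> \sum_v nbrs_deg_eq G j v = j * num_deg_eq G j.
Proof.
move=> sG; rewrite /nbrs_deg_eq exchange_big /= /num_deg_eq big_distrr /=.
apply: eq_bigr => v _; case: eqP => [<-|_].
  by rewrite muln1 degE; apply: eq_bigr => x _; rewrite andbT sG.
by rewrite muln0 big1 // => x _; rewrite andbF.
Qed.

Lemma nbrs_deg_eq_le_deg (n : nat) (G : rel 'I_n) (j : nat) (v : 'I_n) :
  nbrs_deg_eq G j v <= deg G v.
Proof. by rewrite degE; apply: leq_sum => x _; case: (G v x); case: eqP. Qed.

Lemma nbrs_deg_eq_le_num (n : nat) (G : rel 'I_n) (j : nat) (v : 'I_n) :
  nbrs_deg_eq G j v <= num_deg_eq G j.
Proof. by apply: leq_sum => x _; case: (G v x); case: eqP. Qed.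

Lemma num_deg_geS (n : nat) (G : rel 'I_n) (j : nat) :
  num_deg_ge G j = num_deg_eq G j + num_deg_ge G j.+1.
Proof. by rewrite -big_split /=; apply: eq_bigr => v _; lia. Qed.

Lemma num_deg_ge_markov (n : nat) (G : rel 'I_n) (j : nat) :
  j * num_deg_ge G j <= \sum_v deg G v.
Proof.
rewrite big_distrr /=; apply: leq_sum => v _.
by case: (leqP j (deg G v)) => jv; rewrite ?muln1 ?muln0.
Qed.

Lemma edges_ge_geS (n : nat) (G : rel 'I_n) (h j : nat) :
  edges_ge_ge G h j =
    \sum_v (h <= deg G v) * nbrs_deg_eq G j v + edges_ge_ge G h j.+1.
Proof.
rewrite -big_split /=; apply: eq_bigr => x _.
rewrite big_distrr -big_split /=; apply: eq_bigr => y _.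
by case: (G x y); case: (h <= deg G x) => //=; lia.
Qed.

(** * Comparison of the two graphs through one shared card *)

Definition share_cards (m n : nat) (G H : rel 'I_n) (u w : 'I_m -> 'I_n) : Prop :=
  [/\ injective u, injective w &
      forall i, graph_iso (card_del G (u i)) (card_del H (w i))].

Lemma share_cards_sym (m n : nat) (G H : rel 'I_n) (u w : 'I_m -> 'I_n) :
  share_cards G H u w -> share_cards H G w u.
Proof. by case=> ui wi iso; split=> // i; apply: graph_iso_sym. Qed.

Lemma shared_card_sum_deg (n : nat) (G H : rel 'I_n) (u w : 'I_n) :
  simple_graph G -> simple_graph H -> graph_iso (card_del G u) (card_del H w) ->
  \sum_v deg G v + 2 * deg H w = \sum_v deg H v + 2 * deg G u.
Proof.
move=> gG gH iso; rewrite (sum_deg_del u gG) (sum_deg_del w gH).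
rewrite (iso_sum_deg id iso) /=; lia.
Qed.

Lemma shared_card_excess (n : nat) (G H : rel 'I_n) (h : nat) (u w : 'I_n) :
  simple_graph H -> graph_iso (card_del G u) (card_del H w) ->
  excess H h <= excess G h + 2 * deg H w.
Proof.
move=> gH iso; apply: leq_trans (excess_del h w gH) _; rewrite leq_add2r.
by rewrite -(iso_sum_deg (fun x => x - h) iso) sum_deg_del_excess.
Qed.

Lemma shared_card_edges (n : nat) (G H : rel 'I_n) (h j : nat) (u w : 'I_n) :
  simple_graph H -> graph_iso (card_del G u) (card_del H w) ->
  edges_ge_ge H h j <= edges_ge_ge G h j + (2 + h + j) * deg H w.
Proof.
move=> gH iso; apply: leq_trans (edges_ge_ge_del h j w gH) _; rewrite leq_add2r.
rewrite -(iso_sum_edges (fun a b => (h <= a) && (j <= b)) iso).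
exact: edges_ge_ge_del_le.
Qed.

Lemma shared_card_num_deg_ge (n : nat) (G H : rel 'I_n) (j : nat) (u w : 'I_n) :
  simple_graph G -> simple_graph H -> graph_iso (card_del G u) (card_del H w) ->
  deg G u = deg H w ->
  num_deg_ge G j + nbrs_deg_eq H j w = num_deg_ge H j + nbrs_deg_eq G j u.
Proof.
move=> gG gH iso uw; rewrite (num_deg_ge_del j u gG) (num_deg_ge_del j w gH) uw.
rewrite (iso_sum_deg (fun x => j <= x : nat) iso); lia.
Qed.

(** * Equality of the edge numbers *)

Lemma exists_shared_deg_le (d n k : nat) (G : rel 'I_n) (u : 'I_(n - k) -> 'I_n) :
  avg_deg_le G d -> injective u -> d.+1 * k < n -> exists i, deg G (u i) <= d.
Proof.
move=> aG u_inj kn; apply/existsP; apply: contraT => /existsPn /= all_gt.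
have := aG; rewrite /avg_deg_le (sum_codom_split _ u_inj).
(* This would exceed [d * n], because [d.+1 * k < n]. *)
suff: (n - k) * d.+1 <= \sum_i deg G (u i) by nia.
rewrite -{1}(card_ord (n - k)) -sum_nat_const; apply: leq_sum => i _.
by rewrite ltnNge; apply: all_gt.
Qed.

Lemma sum_deg_le_shared (d n k : nat) (G H : rel 'I_n) (u w : 'I_(n - k) -> 'I_n) :
  3 <= n -> 0 < d -> 1000 * (k * d) <= n ->
  simple_graph G -> simple_graph H -> avg_deg_le G d ->
  share_cards G H u w ->
  \sum_v deg G v <= \sum_v deg H v.
Proof.
move=> n3 d0 kn gG gH aG [ui wi iso]; rewrite leqNgt; apply/negP => ltD.
have le_kn : k <= n by nia.
have [|i0 low] := exists_shared_deg_le aG ui; first by nia.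
have deg2 i := shared_card_sum_deg gG gH (iso i).
(* [t] is the difference of the edge numbers; every shared pair has this same degree difference. *)
pose t := deg G (u i0) - deg H (w i0).
have Dt : \sum_v deg G v = \sum_v deg H v + 2 * t.
  by have := deg2 i0; rewrite /t; lia.
have t0 : 0 < t by lia.
have degt i : deg G (u i) = deg H (w i) + t by have := deg2 i; lia.
have SU : \sum_i deg G (u i) = \sum_i deg H (w i) + (n - k) * t.
  rewrite -[X in _ + X * _](card_ord (n - k)) -sum_nat_const -big_split /=.
  by apply: eq_bigr => i _; rewrite degt.
have splitG := sum_codom_split (deg G) ui.
have splitH := sum_codom_split (deg H) wi.
(* If the sizes differed, the [k] missing vertices of [H] would carry about [n * t]
   more degree than those of [G]; comparing excesses over [h] on one low-degree
   card, and card by card on the shared vertices, rules this out. *)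
set h := 3 * d.
have XG := sum_codom_split (fun v => deg G v - h) ui.
have XH := sum_codom_split (fun v => deg H v - h) wi.
rewrite -/(excess G h) in XG; rewrite -/(excess H h) in XH.
have XX := shared_card_excess h gH (iso i0).
have XMG : \sum_(v | v \notin codom u) (deg G v - h) <= \sum_(v | v \notin codom u) deg G v.
  by apply: leq_sum => v _; rewrite leq_subr.
have MH : \sum_(v | v \notin codom w) deg H v <=
    k * h + \sum_(v | v \notin codom w) (deg H v - h).
  rewrite -[X in X * _](card_notin_codom le_kn wi) -sum_nat_const -big_split /=.
  by apply: leq_sum => v _; lia.
have hubs := num_deg_ge_markov G h; rewrite /avg_deg_le in aG.
have hubU := sum_codom_split (fun v => h <= deg G v : nat) ui.
rewrite -/(num_deg_ge G h) in hubU.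
(* Raising a degree by [t] raises its excess by at most [t], and only if the new degree reaches
   [h]. *)
have XU : \sum_i (deg G (u i) - h) <=
    \sum_i (deg H (w i) - h) + t * \sum_i (h <= deg G (u i)).
  rewrite big_distrr -big_split /=; apply: leq_sum => i _; rewrite degt.
  by case: leqP => hi; rewrite ?muln1 ?muln0; lia.
(* The factor 3 in [h] serves here: at most a third of the vertices reach [h], so
   [t * num_deg_ge G h] cannot absorb [(n - k) * t]. *)
have hubn : 3 * num_deg_ge G h <= n.
  by rewrite -(leq_pmul2l d0) mulnA (mulnC d) (leq_trans hubs aG).
(* With no missing vertex the two degree sums differ by both [n * t] and [2 * t], against
   [3 <= n]. *)
have [k0|k0] := posnP k.
  have MH0 : \sum_(v | v \notin codom w) deg H v = 0.
    rewrite big_pred0 // => v; have := card0_eq (etrans (card_notin_codom le_kn wi) k0).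
    by move=> /(_ v).
  have : 3 * t <= (n - k) * t by rewrite k0 subn0 leq_mul2r n3 orbT.
  lia.
have key : (n - k) * t <= k * h + t * num_deg_ge G h + 2 * d + 2 * t.
  have : t * \sum_i (h <= deg G (u i)) <= t * num_deg_ge G h.
    by rewrite leq_mul2l hubU leq_addr orbT.
  move: XMG MH XX XG XH XU SU splitG splitH hubU Dt low (degt i0); clear; lia.
have nt : 3 * (t * num_deg_ge G h) <= t * n by rewrite mulnCA leq_mul2l hubn orbT.
have k1 : k <= k * d by rewrite leq_pmulr.
have d1 : d <= k * d by rewrite leq_pmull.
have p1 : k * d <= k * d * t by rewrite leq_pmulr.
have p2 : k * t <= k * d * t by rewrite leq_mul2r k1 orbT.
have p3 : t <= k * d * t by rewrite leq_pmull // muln_gt0 k0.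
have p4 : 1000 * (k * d * t) <= n * t by rewrite mulnA leq_mul2r kn orbT.
move: key nt p1 p2 p3 p4 d1 t0; rewrite mulnBl (mulnC t n) /h (mulnCA k 3 d).
move: (n * t) (k * d * t) (k * d) (k * t) (t * _) => a b c e f; clear; lia.
Qed.

(** * Balance over all shared cards, and descent on the threshold *)

Lemma shared_balance (n k : nat) (G H : rel 'I_n) (u w : 'I_(n - k) -> 'I_n) (j : nat) :
  simple_graph G -> simple_graph H -> share_cards G H u w ->
  (forall i, deg G (u i) = deg H (w i)) ->
  (n - k) * num_deg_ge G j + j * num_deg_eq H j
      + \sum_(v | v \notin codom u) nbrs_deg_eq G j v =
  (n - k) * num_deg_ge H j + j * num_deg_eq G j
      + \sum_(v | v \notin codom w) nbrs_deg_eq H j v.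
Proof.
move=> gG gH [ui wi iso] uw.
(* Double counting completes the sums to all vertices; what remains is the one-card identity summed
   over the shared cards. *)
rewrite -(sum_nbrs_deg_eq j gG.1) -(sum_nbrs_deg_eq j gH.1).
rewrite (sum_codom_split (nbrs_deg_eq G j) ui) (sum_codom_split (nbrs_deg_eq H j) wi).
suff : (n - k) * num_deg_ge G j + \sum_i nbrs_deg_eq H j (w i) =
       (n - k) * num_deg_ge H j + \sum_i nbrs_deg_eq G j (u i) by lia.
rewrite -[X in X * _ + _ = _](card_ord (n - k)) -[X in _ = X * _ + _](card_ord (n - k)).
rewrite -!sum_nat_const -!big_split; apply: eq_bigr => i _ /=.
exact: shared_card_num_deg_ge.
Qed.

(** By Markov at most [d * n / j] vertices have degree [j], and each of the [k] missing vertices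
    sees at most all of them. *)
Lemma missing_nbrs_small (d n k j : nat) (G : rel 'I_n) (u : 'I_(n - k) -> 'I_n) :
  0 < k -> 0 < d -> k <= n -> injective u -> avg_deg_le G d ->
  10 * (k * d ^ 2) <= j ->
  10 * (d * \sum_(v | v \notin codom u) nbrs_deg_eq G j v) <= n.
Proof.
move=> k0 d0 le_kn ui aG jlarge.
have M := sum_notin_codom_le le_kn ui (nbrs_deg_eq_le_num G j).
have J : j * num_deg_eq G j <= d * n.
  apply: leq_trans aG; apply: leq_trans (num_deg_ge_markov G j).
  by rewrite leq_mul2l (num_deg_geS G j) leq_addr orbT.
have kd0 : 0 < k * d by rewrite muln_gt0 k0.
rewrite -(leq_pmul2l kd0).
apply: (@leq_trans (10 * (k * d ^ 2) * (k * num_deg_eq G j))).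
  rewrite (_ : k * d * _ = 10 * (k * d ^ 2) * \sum_(v | v \notin codom u) nbrs_deg_eq G j v).
    by rewrite leq_mul2l M orbT.
  by rewrite -mulnn; lia.
apply: (@leq_trans (j * (k * num_deg_eq G j))); first by rewrite leq_mul2r jlarge orbT.
by rewrite mulnCA -mulnA leq_mul2l J orbT.
Qed.

(** On a shared card with [deg G (u i) <= d] the correction term is at most [d]. *)
Lemma shared_num_deg_ge_near (d n k : nat) (G H : rel 'I_n) (u w : 'I_(n - k) -> 'I_n) (j : nat) :
  simple_graph G -> simple_graph H -> share_cards G H u w ->
  (forall i, deg G (u i) = deg H (w i)) -> (exists i, deg G (u i) <= d) ->
  num_deg_ge G j <= num_deg_ge H j + d.
Proof.
move=> gG gH [_ _ iso] uw [i low].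
have := shared_card_num_deg_ge j gG gH (iso i) (uw i).
have := nbrs_deg_eq_le_deg G j (u i); lia.
Qed.

(** The shift of indices lets two balances be combined: the one at [q.+1] forces [q] to be at least
    about [n - k], and the one at [q] then leaves [q * s] with nothing of its size to cancel it. *)
Lemma high_degree_step (d n k : nat) (G H : rel 'I_n) (u w : 'I_(n - k) -> 'I_n) (q : nat) :
  0 < d -> 0 < k -> 1000 * (k * d) <= n ->
  simple_graph G -> simple_graph H -> avg_deg_le H d ->
  share_cards G H u w ->
  (forall i, deg G (u i) = deg H (w i)) -> (exists i, deg G (u i) <= d) ->
  q.+1 < n -> 10 * (k * d ^ 2) <= q ->
  num_deg_ge G q.+2 = num_deg_ge H q.+2 ->
  num_deg_ge G q.+1 <= num_deg_ge H q.+1.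
Proof.
move=> d0 k0 kn gG gH aH sh uw low qn qlarge eq2; rewrite leqNgt; apply/negP => lt1.
have lowH : exists i, deg H (w i) <= d by have [i lowi] := low; exists i; rewrite -uw.
have shH := share_cards_sym sh.
have k1 : k <= k * d by rewrite leq_pmulr.
have d1 : d <= k * d by rewrite leq_pmull.
have le_kn : k <= n by lia.
have near := shared_num_deg_ge_near q gG gH sh uw low.
have near' := shared_num_deg_ge_near q gH gG shH (fun i => esym (uw i)) lowH.
have [_ wi _] := sh.
have M0 := missing_nbrs_small k0 d0 le_kn wi aH qlarge.
have M1 := missing_nbrs_small k0 d0 le_kn wi aH (leqW qlarge).
have B0 := shared_balance q gG gH sh uw.
have B1 := shared_balance q.+1 gG gH sh uw.
have G0 := num_deg_geS G q; have G1 := num_deg_geS G q.+1.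
have H0 := num_deg_geS H q; have H1 := num_deg_geS H q.+1.
move: M0 M1 B0 B1 G0 G1 H0 H1 near near' lt1 eq2 kn k1 d1 qn d0 k0.
move: (\sum_(v | v \notin codom u) nbrs_deg_eq G q v).
move: (\sum_(v | v \notin codom u) nbrs_deg_eq G q.+1 v).
move: (\sum_(v | v \notin codom w) nbrs_deg_eq H q v).
move: (\sum_(v | v \notin codom w) nbrs_deg_eq H q.+1 v).
move: (num_deg_ge G q) (num_deg_ge G q.+1) (num_deg_ge G q.+2).
move: (num_deg_ge H q) (num_deg_ge H q.+1) (num_deg_ge H q.+2).
move: (num_deg_eq G q) (num_deg_eq G q.+1).
move: (num_deg_eq H q) (num_deg_eq H q.+1).
(* Pure arithmetic from here. Suffix [i] refers to degree [q + i]: [A], [a], [g] are the threshold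
   count, exact count and missing sum of [G]; [B], [b], [h] are those of [H]. *)
clear => b0 b1 a0 a1 B0 B1 B2 A0 A1 A2 h1 h0 g1 g0.
move=> M0 M1 E0 E1 eA0 eA1 eB0 eB1 near near' lt1 eq2 kn k1 d1 qn d0 k0.
have h0n : 10 * h0 <= n by apply: leq_trans M0; rewrite leq_mul2l leq_pmull.
have h1n : h1 <= d * h1 by rewrite leq_pmull.
pose s := A1 - B1.
have As : A1 = B1 + s by rewrite /s; lia.
have s0 : 0 < s by lia.
have a1s : a1 = b1 + s by lia.
have top : (n - k) * s + g1 = q.+1 * s + h1.
  by move: E1; rewrite As a1s !mulnDr; lia.
have nkq : n - k <= q.+1 + h1.
  case: (leqP (n - k) q.+1) => [|lt]; first by lia.
  have : n - k - q.+1 <= (n - k - q.+1) * s by rewrite leq_pmulr.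
  by rewrite mulnBl; lia.
have qs : q <= q * s by rewrite leq_pmulr.
(* In the balance at [q], [A0 - B0] has coefficient [n - k - q], whose sign decides whether [near']
   or [near] bounds the product. Its absolute value [c] is at most [h1 + 1] or [k] respectively. *)
case: (leqP q (n - k)) => [le|lt].
  set c := n - k - q.
  have nkE : n - k = q + c by rewrite /c; lia.
  have dc : d * c <= d * h1 + d by rewrite -mulnSr leq_mul2l; apply/orP; right; lia.
  have cB : c * B0 <= c * A0 + d * c by rewrite (mulnC d) -mulnDr leq_mul2l near' orbT.
  have : q * s + c * A0 <= c * B0 + h0.
    by move: E0; rewrite nkE eA0 eB0 As !mulnDr !mulnDl; lia.
  lia.
set c := q - (n - k).
have qE : q = n - k + c by rewrite /c; lia.
have cA : c * A0 <= c * B0 + c * d by rewrite -mulnDr leq_mul2l near orbT.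
have cd : c * d <= k * d by rewrite leq_mul2r; apply/orP; right; lia.
have : q * s + c * B0 <= c * A0 + h0.
  by move: E0; rewrite qE eA0 eB0 As !mulnDr !mulnDl; lia.
lia.
Qed.

Lemma low_degree_step (d n k : nat) (G H : rel 'I_n) (u w : 'I_(n - k) -> 'I_n) (q : nat) :
  0 < d -> 0 < k -> 1000 * (k * d ^ 3) <= n ->
  simple_graph G -> simple_graph H -> avg_deg_le G d ->
  share_cards G H u w ->
  (forall i, deg G (u i) = deg H (w i)) -> (exists i, deg G (u i) <= d) ->
  q <= 10 * (k * d ^ 2) ->
  num_deg_ge G q.+1 = num_deg_ge H q.+1 ->
  num_deg_ge G q <= num_deg_ge H q.
Proof.
move=> d0 k0 kn gG gH aG sh uw [i0 low] qsmall eq1; rewrite leqNgt; apply/negP => lt0.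
pose s := num_deg_ge G q - num_deg_ge H q.
have As : num_deg_ge G q = num_deg_ge H q + s by rewrite /s; lia.
have s0 : 0 < s by lia.
have [ui wi iso] := sh.
have nbrs i : nbrs_deg_eq G q (u i) = nbrs_deg_eq H q (w i) + s.
  by have := shared_card_num_deg_ge q gG gH (iso i) (uw i); lia.
(* Vertices of degree at least [h] are few, yet must carry nearly all edges from
   the missing vertices to the vertices of degree [q]. *)
set h := 40 * d.
have splitG := sum_codom_split (fun v => (h <= deg G v) * nbrs_deg_eq G q v) ui.
have splitH := sum_codom_split (fun v => (h <= deg H v) * nbrs_deg_eq H q v) wi.
(* With [h = 40 * d], the term [s * num_deg_ge G h] is at most a fortieth of [s * n]. *)
have hubs : 40 * num_deg_ge G h <= n.
  rewrite -(leq_pmul2l d0) mulnA (mulnC d).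
  exact: leq_trans (num_deg_ge_markov G h) aG.
have hubU := sum_codom_split (fun v => h <= deg G v : nat) ui.
rewrite -/(num_deg_ge G h) in hubU.
have shared : \sum_i (h <= deg G (u i)) * nbrs_deg_eq G q (u i) =
    \sum_i (h <= deg H (w i)) * nbrs_deg_eq H q (w i) + s * \sum_i (h <= deg G (u i)).
  rewrite big_distrr -big_split /=; apply: eq_bigr => i _.
  by rewrite nbrs uw mulnDr (mulnC s).
have MG : \sum_(v | v \notin codom u) (h <= deg G v) * nbrs_deg_eq G q v <=
    \sum_(v | v \notin codom u) nbrs_deg_eq G q v.
  by apply: leq_sum => v _; case: (h <= _); rewrite ?mul1n.
have d2 : d ^ 2 = d * d by rewrite -mulnn.
have d3 : d ^ 3 = d * (d * d) by rewrite !expnS expn0 muln1.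
have k1 : k <= k * d ^ 3 by rewrite leq_pmulr // expn_gt0 d0.
have le_kn : k <= n by lia.
have MH : \sum_(v | v \notin codom w) nbrs_deg_eq H q v <=
    k * h + \sum_(v | v \notin codom w) (h <= deg H v) * nbrs_deg_eq H q v.
  rewrite -[X in X * _](card_notin_codom le_kn wi) -sum_nat_const -big_split /=.
  apply: leq_sum => v _; have := nbrs_deg_eq_le_deg H q v.
  by case: (leqP h (deg H v)); rewrite ?mul1n ?mul0n; lia.
have isoH := graph_iso_sym (iso i0).
(* The pairs from degree at least [h] to degree exactly [q] are a difference of two threshold
   counts, so bounding those of [H] by those of [G] takes opposite comparisons at [q] and [q.+1]. *)
have E1 := shared_card_edges h q gH (iso i0).
have E2 := shared_card_edges h q.+1 gG isoH.
have PG := edges_ge_geS G h q; have PH := edges_ge_geS H h q.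
have loss j : (2 + h + j) * deg G (u i0) <= (2 + h + j) * d.
  by rewrite leq_mul2l low orbT.
have L1 := loss q; have L2 := loss q.+1; rewrite -uw in E1.
have sh' : s * \sum_i (h <= deg G (u i)) <= s * num_deg_ge G h.
  by rewrite leq_mul2l hubU leq_addr orbT.
have B := shared_balance q gG gH sh uw.
have GS := num_deg_geS G q; have HS := num_deg_geS H q.
have eqs : num_deg_eq G q = num_deg_eq H q + s by lia.
have key : (n - k) * s <=
    q * s + k * h + s * num_deg_ge G h + (2 + h + q) * d + (2 + h + q.+1) * d.
  rewrite As eqs !mulnDr in B; lia.
have hubs' : 40 * (s * num_deg_ge G h) <= s * n by rewrite mulnCA leq_mul2l hubs orbT.
have le_pow m : 0 < m -> m <= 3 -> k * d ^ m <= k * d ^ 3.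
  by move=> m0 m3; rewrite leq_mul2l leq_pexp2l // orbT.
have dkkk := le_pow 2 isT isT.
have dkk : k * d <= k * d ^ 3 := le_pow 1 isT isT.
have dk : d <= k * d ^ 3 by apply: leq_trans dkk; rewrite leq_pmull.
have ddk : d * d <= k * d ^ 3 by apply: leq_trans dkkk; rewrite d2 leq_pmull.
(* The cube of [d] arises here: deleting a vertex of degree at most [d] costs about [q * d], with
   [q] up to order [k * d ^ 2]. *)
have qd : q * d <= 10 * (k * d ^ 3).
  apply: leq_trans (leq_mul qsmall (leqnn d)) _; rewrite d3 d2; lia.
have kds : k * d ^ 3 <= k * d ^ 3 * s by rewrite leq_pmulr.
have ks : k * s <= k * d ^ 3 * s by rewrite leq_mul2r k1 orbT.
have qs : q * s <= 10 * (k * d ^ 3) * s by rewrite leq_mul2r; apply/orP; right; lia.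
have ns : 1000 * (k * d ^ 3) * s <= n * s by rewrite leq_mul2r kn orbT.
have pos : 0 < k * d ^ 3 * s by rewrite muln_gt0 s0 andbT (leq_trans k0).
have e1 : (2 + h + q) * d = 2 * d + 40 * (d * d) + q * d by rewrite /h; lia.
have e2 : (2 + h + q.+1) * d = 3 * d + 40 * (d * d) + q * d by rewrite /h; lia.
have e3 : k * h = 40 * (k * d) by rewrite /h mulnCA.
rewrite mulnBl e1 e2 e3 in key.
rewrite (mulnC s n) in hubs'; rewrite -mulnA in qs; rewrite -mulnA in ns.
move: key hubs' dk ddk dkk qd kds ks qs ns pos.
move: (k * d ^ 3 * s) (k * d ^ 3) (n * s) (q * s) (k * s) (s * _) (q * d) (d * d) (k * d).
by clear; lia.
Qed.

Lemma num_deg_ge_step (d n k : nat) (G H : rel 'I_n) (u w : 'I_(n - k) -> 'I_n) (q : nat) :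
  0 < d -> 1000 * (k * d ^ 3) <= n ->
  simple_graph G -> simple_graph H -> avg_deg_le G d -> avg_deg_le H d ->
  share_cards G H u w ->
  (forall i, deg G (u i) = deg H (w i)) -> (exists i, deg G (u i) <= d) ->
  q < n -> num_deg_ge G q.+1 = num_deg_ge H q.+1 ->
  num_deg_ge G q <= num_deg_ge H q.
Proof.
move=> d0 kn gG gH aG aH sh uw low qn eq1.
have [k0|k0] := posnP k; last first.
  have [small|large] := leqP q (10 * (k * d ^ 2)); first exact: (low_degree_step d0 k0 kn gG gH aG sh).
  case: q => // q in qn eq1 large *.
  apply: (high_degree_step d0 k0 _ gG gH aH sh) => //.
  apply: leq_trans kn; rewrite !leq_mul2l (leq_pexp2l d0 (isT : 1 <= 3)).
  by rewrite !orbT.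
(* Without missing vertices the balance gives [(n - q) * s <= 0], excluded by [q < n]. *)
have [ui wi iso] := sh.
have missing0 : \sum_(v | v \notin codom w) nbrs_deg_eq H q v = 0.
  apply/eqP; rewrite -leqn0 -[0](mul0n (num_deg_eq H q)) -{2}k0.
  by apply: sum_notin_codom_le => // [|v]; [lia | exact: nbrs_deg_eq_le_num].
rewrite leqNgt; apply/negP => lt0.
have B := shared_balance q gG gH sh uw.
have GS := num_deg_geS G q; have HS := num_deg_geS H q.
pose s := num_deg_ge G q - num_deg_ge H q.
have As : num_deg_ge G q = num_deg_ge H q + s by rewrite /s; lia.
have s0 : 0 < s by lia.
have eqs : num_deg_eq G q = num_deg_eq H q + s by lia.
have lts : q * s < (n - k) * s by rewrite ltn_pmul2r // k0 subn0.
rewrite As eqs missing0 !mulnDr in B; lia.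
Qed.

(** * From threshold counts to the degree sequence *)

Lemma num_deg_ge_large (n : nat) (G : rel 'I_n) (j : nat) :
  simple_graph G -> n <= j -> num_deg_ge G j = 0.
Proof.
move=> [_ iG] nj; rewrite /num_deg_ge big1 // => v _.
have : deg G v < #|'I_n|.
  rewrite /deg -cardsT; apply: proper_card; rewrite properT.
  by apply/eqP => /setP/(_ v); rewrite !inE iG.
by rewrite card_ord; lia.
Qed.

(** The multiplicity of [j] is the drop of the threshold count from [j] to [j.+1]. *)
Lemma same_degree_sequence_num (n : nat) (G H : rel 'I_n) :
  (forall j, num_deg_ge G j = num_deg_ge H j) -> same_degree_sequence G H.
Proof.
move=> eqA.
have cnt (K : rel 'I_n) j : count_mem j [seq deg K v | v <- enum 'I_n] = num_deg_eq K j.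
  rewrite count_map -sum1_count /num_deg_eq big_enum_cond big_mkcond /=.
  by apply: eq_bigr => v _; case: eqP.
apply/allP => j _ /=; rewrite !cnt.
by have := num_deg_geS G j; have := num_deg_geS H j; rewrite !eqA; lia.
Qed.

Theorem theorem1p1 (d n k : nat) (G H : rel 'I_n) :
  3 <= n ->
  k * (10 ^ 4 * d ^ 3) <= n ->
  simple_graph G -> simple_graph H ->
  avg_deg_le G d -> avg_deg_le H d ->
  (exists (u w : 'I_(n - k) -> 'I_n),
      injective u /\ injective w /\
      forall i, graph_iso (card_del G (u i)) (card_del H (w i))) ->
  same_degree_sequence G H.
Proof.
move=> n3 kn gG gH aG aH [u [w [ui [wi iso]]]]; apply: same_degree_sequence_num.
(* For [d = 0] the bound on [k] says nothing, but both graphs are edgeless. *)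
have [d0|d0] := posnP d.
  have zero (K : rel 'I_n) : avg_deg_le K d -> forall v, deg K v = 0.
    rewrite /avg_deg_le d0 leqn0 sum_nat_eq0 => /forallP z v.
    by have /eqP := z v.
  by move=> j; apply: eq_bigr => v _; rewrite !zero.
have sh : share_cards G H u w by [].
have shH := share_cards_sym sh.
have {}kn : 1000 * (k * d ^ 3) <= n.
  apply: leq_trans kn; rewrite mulnCA leq_mul2l leq_mul2r; apply/orP; right.
  by apply/orP; right; rewrite expnS; lia.
have kdn : 1000 * (k * d) <= n.
  apply: leq_trans kn; rewrite !leq_mul2l (leq_pexp2l d0 (isT : 1 <= 3)).
  by rewrite !orbT.
have eqD : \sum_v deg G v = \sum_v deg H v.
  apply/eqP; rewrite eqn_leq (sum_deg_le_shared n3 d0 kdn gG gH aG sh).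
  exact: (sum_deg_le_shared n3 d0 kdn gH gG aH shH).
have uw i : deg G (u i) = deg H (w i).
  by have := shared_card_sum_deg gG gH (iso i); lia.
have low : exists i, deg G (u i) <= d.
  apply: exists_shared_deg_le => //; have : k <= k * d by rewrite leq_pmulr.
  by rewrite mulSn (mulnC d); lia.
have lowH : exists i, deg H (w i) <= d by have [i lowi] := low; exists i; rewrite -uw.
(* Downward induction on the threshold, starting at [j >= n], where both counts vanish. *)
suff down m j : n <= j + m -> num_deg_ge G j = num_deg_ge H j.
  by move=> j; apply: (down n); apply: leq_addl.
elim: m j => [|m IH] j le_n.
  by rewrite addn0 in le_n; rewrite !num_deg_ge_large.
have [lt_n|ge_n] := ltnP j n; last by apply: IH; lia.
have eq1 : num_deg_ge G j.+1 = num_deg_ge H j.+1 by apply: IH; lia.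
apply/eqP; rewrite eqn_leq (num_deg_ge_step d0 kn gG gH aG aH sh) //.
by rewrite (num_deg_ge_step d0 kn gH gG aH aG shH).
Qed.
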